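(* Let $G$ be a locally compact abelian group with Haar measure $\mu$ and let $S\subset G$ be a Borel measurable set with $\overline{D}(S)>0$. Then the difference set $S-S$ is syndetic. Moreover, the set of translations $K$ for which $G=K+(S-S)$ can be chosen not only compact but even finite, with $\#K\le[1/\overline{D}(S)]$ elements, where $[\cdot]$ denotes the integer part.
   Context: Let $\mathcal{B}_0$ be the family of Borel subsets of $G$ with compact closure, and write $C\Subset G$ for ''$C$ is a compact subset of $G$''. For a Borel set $S\subset G$ define $$\overline{D}(S):=\overline{D}(\mu|_S;\mu):=\inf_{C\Subset G}\ \sup_{V\in\mathcal{B}_0}\frac{\mu(S\cap V)}{\mu(C+V)}.$$ Conventions: $C\ne\emptyset$; $\mu(C+V)$ means outer measure if $C+V$ is not measurable; a quotient $0/0$ is read as $0$. A subset $T\subset G$ is called syndetic if there is a compact set $K\subset G$ such that for every $g\in G$ there is $k\in K$ with $g+k\in T$ (equivalently $\bigcup_{k\in K}(T-k)=G$). Here $S-S=\{s-s':s,s'\in S\}$. *)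

(* Defs.v *)
From HB Require Import structures.
From mathcomp Require Import all_boot all_order all_algebra finmap.
From mathcomp Require Import all_classical all_reals all_analysis.

Set Implicit Arguments.
Unset Strict Implicit.
Unset Printing Implicit Defensive.

Import Order.TTheory GRing.Theory Num.Theory.

Local Open Scope classical_set_scope.
Local Open Scope ring_scope.
Local Open Scope ereal_scope.

Definition sumset (G : zmodType) (A B : set G) : set G :=
  [set (a + b)%R | a in A & b in B].

Definition diffset (G : zmodType) (A B : set G) : set G :=
  [set (a - b)%R | a in A & b in B].

Definition syndetic (G : topologicalZmodType) (T : set G) : Prop :=
  exists2 K : set G, compact K &
    forall g : G, exists2 k : G, K k & T (g + k)%R.

(* As is customary, locally compact groups are assumed to be Hausdorff. *)
Definition lca_group (G : topologicalZmodType) : Prop :=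
  hausdorff_space G /\ locally_compact [set: G].

(* G with its Borel sigma-algebra, generated by the open sets. Measurable types
   are required to be pointed; the base point plays no other role. *)
Definition borelType (G : topologicalZmodType) : Type := G.

HB.instance Definition _ (G : topologicalZmodType) :=
  Choice.copy (borelType G) G.
HB.instance Definition _ (G : topologicalZmodType) :=
  isPointed.Build (borelType G) (0%R : G).

Lemma borel_measurableC (G : topologicalZmodType) (A : set G) :
  <<s @open G >> A -> <<s @open G >> (~` A).
Proof. by move=> sA; rewrite -setTD; exact: sigma_algebraCD. Qed.

HB.instance Definition _ (G : topologicalZmodType) :=
  @isMeasurable.Build (sigma_display (@open G)) (borelType G)
    <<s @open G >> (@sigma_algebra0 _ setT (@open G))
    (@borel_measurableC G) (@sigma_algebra_bigcup _ setT (@open G)).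

(* Nonzero translation-invariant Radon measure. Compact sets are Borel
   as soon as G is Hausdorff. *)
Record haar_measure (R : realType) (G : topologicalZmodType)
    (mu : {measure set (borelType G) -> \bar R}) : Prop := HaarMeasure {
  haar_neq0 : mu [set: G] != 0 ;
  haar_translation : forall (g : G) (B : set (borelType G)), measurable B ->
    mu [set (g + b)%R | b in B] = mu B ;
  haar_compact_fin : forall K : set G, compact K -> mu K < +oo ;
  haar_outer_regular : forall B : set (borelType G), measurable B ->
    mu B = ereal_inf [set mu U | U in [set U : set G | open U /\ B `<=` U]] ;
  haar_inner_regular : forall U : set G, open U ->
    mu U = ereal_sup [set mu K | K in [set K : set G | compact K /\ K `<=` U]]
}.

Definition borel_precompact (G : topologicalZmodType) (V : set G) : Prop :=
  measurable (V : set (borelType G)) /\ compact (closure V).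

(* [mu^*] is the outer measure induced by [mu]; it agrees with [mu] on Borel
   sets ([measurable_mu_extE]). In [\bar R], [0 / 0 = 0 * +oo = 0]. *)
Definition upper_density (R : realType) (G : topologicalZmodType)
    (mu : {measure set (borelType G) -> \bar R}) (S : set G) : \bar R :=
  ereal_inf [set ereal_sup [set mu (S `&` V) / (mu^*)%mu (sumset C V)
                           | V in @borel_precompact G]
            | C in [set C : set G | compact C /\ C !=set0]].

(* Main.v *)
Require Import Defs.
From HB Require Import structures.
From mathcomp Require Import all_boot all_order all_algebra finmap.
From mathcomp Require Import all_classical all_reals all_analysis.
Import Order.TTheory GRing.Theory Num.Theory.
Local Open Scope classical_set_scope.
Local Open Scope ring_scope.

(* If the translates of S by the points of a finite set K are pairwise
   disjoint, then mu(K + V) >= #K mu(S `&` V) for every V, so taking C = K in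
   the definition of the density D of S gives D <= 1/#K. Hence there is a K of
   maximal cardinality with this property, and by maximality every g differs
   from some point of K by an element of S - S. *)

(** As a preimage under a continuous map, a translate of a Borel set is visibly Borel. *)
Lemma translateE {G : zmodType} (g : G) (B : set G) :
  [set g + b | b in B] = (fun x => x - g) @^-1` B.
Proof.
apply/seteqP; split => [_ [b Bb <-]|x Bx] /=; first by rewrite addrC addKr.
by exists (x - g) => //; rewrite addrC subrK.
Qed.

Lemma measurable_preimage_continuous {G : topologicalZmodType} {f : G -> G}
    {B : set (borelType G)} :
  continuous f -> measurable B -> measurable (f @^-1` B : set (borelType G)).
Proof.
move=> /continuousP cf mB; rewrite -[_ @^-1` _]setTI.
suff: measurable_fun [set: borelType G] (f : borelType G -> borelType G).
  by move=> /(_ measurableT); apply.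
apply: (@measurability _ _ (borelType G) (borelType G) _ _ (@open G)) => //.
move=> _ [U oU <-]; rewrite setTI.
by apply: sub_sigma_algebra; exact: cf.
Qed.

Lemma measurable_translate {G : topologicalZmodType} (g : G)
    {B : set (borelType G)} :
  measurable B -> measurable ([set g + b | b in B] : set (borelType G)).
Proof.
rewrite translateE; apply: measurable_preimage_continuous => x.
apply: (@continuous_comp _ _ _ (fun x : G => (x, g)) (fun z => z.1 - z.2)).
  by apply: cvg_pair; [exact: cvg_id|exact: cvg_cst].
exact: tvs.sub_continuous.
Qed.

Lemma haar_precompact_fin {R : realType} {G : topologicalZmodType}
    {mu : {measure set (borelType G) -> \bar R}} {V : set (borelType G)} :
  haar_measure mu -> borel_precompact V -> (mu V < +oo)%E.
Proof.
move=> hmu [mV cV]; apply: le_lt_trans (haar_compact_fin hmu cV).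
apply: le_measure; rewrite ?inE //; last exact: subset_closure.
rewrite -[closure _]setCK; apply: measurableC; apply: sub_sigma_algebra.
by apply: closed_openC; exact: closed_closure.
Qed.

(** This expresses that [k + S] and [l + S] are disjoint: [k + s = l + t] means [k - l = t - s]. *)
Definition disjoint_translates {G : zmodType} (S : set G) (K : {fset G}) :=
  {in K &, forall k l : G, k != l -> ~ diffset S S (k - l)}.

Lemma disjoint_translates_le_mu_ext {R : realType} {G : topologicalZmodType}
    {mu : {measure set (borelType G) -> \bar R}} {S V : set (borelType G)}
    {K : {fset G}} :
  haar_measure mu -> measurable S -> measurable V ->
  disjoint_translates (S : set G) K ->
  ((#|` K|%:R)%:E * mu (S `&` V) <= (mu^*)%mu (sumset [set` K] (V : set G)))%E.
Proof.
move=> hmu mS mV dK; have mSV := measurableI _ _ mS mV.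
pose F (k : G) : set (borelType G) := [set k + b | b in S `&` V].
have mF k : measurable (F k) by exact: measurable_translate.
have tF : trivIset [set` K] F.
  move=> k l kK lK [_ [[s [Ss _] <-] [t [St _] e]]].
  apply: contrapT => /eqP kl; apply: (dK _ _ kK lK kl).
  exists t => //; exists s => //.
  by apply/eqP; rewrite subr_eq addrAC eq_sym subr_eq -e addrC.
have -> : ((#|` K|%:R)%:E * mu (S `&` V) = mu (\bigcup_(k in [set` K]) F k))%E.
  rewrite bigcup_fset measure_fbigsetU // (eq_bigr (fun=> mu (S `&` V))).
    by rewrite big_const_seq count_predT iter_addr_0 mule_natl.
  by move=> k _; exact: haar_translation.
(* Passing to [mu^*] lets monotonicity apply directly to the set K + V. *)
rewrite -measurable_mu_extE; last by apply: fin_bigcup_measurable.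
apply: le_mu_ext => _ [k kK [b [_ Vb] <-]].
by exists k => //; exists b.
Qed.

Lemma lee_pdiv_invr {R : realType} {r : R} {x y : \bar R} :
  (0 < r)%R -> (0 <= x -> x < +oo -> r%:E * x <= y -> x / y <= r^-1%:E)%E.
Proof.
move=> r0; case: x => // a; rewrite lee_fin => a0 _.
(* For [y = +oo] the quotient is [0], since the inverse of [+oo] is [0]. *)
rewrite -EFinM; case: y => [b||//]; last first.
  by move=> _; rewrite /inve mule0 lee_fin invr_ge0 ltW.
rewrite lee_fin => rab.
(* When [a = 0], [b] may vanish too, and then the quotient is [0 * +oo = 0]. When [a > 0], the bound
   [r * a <= b] forces [b > 0]. *)
have [->|an0] := eqVneq a 0; first by rewrite mul0e lee_fin invr_ge0 ltW.
have apos : 0 < a by rewrite lt_neqAle eq_sym an0.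
have bpos : 0 < b by apply: lt_le_trans rab; rewrite mulr_gt0.
rewrite /inve gt_eqF // -EFinM lee_fin ler_pdivrMr // mulrC.
by rewrite ler_pdivlMr // mulrC.
Qed.

Lemma upper_density_le {R : realType} {G : topologicalZmodType}
    {mu : {measure set (borelType G) -> \bar R}} {S : set (borelType G)}
    {K : {fset G}} :
  haar_measure mu -> measurable S ->
  disjoint_translates (S : set G) K -> K != fset0 ->
  (upper_density mu S <= (#|` K|%:R^-1)%:E)%E.
Proof.
move=> hmu mS dK K0.
have n0 : 0 < #|` K|%:R :> R by rewrite ltr0n cardfs_gt0.
apply: ge_ereal_inf; eexists; first exists [set` K].
- split; first by apply: finite_compact; exact: finite_fset.
  by have /fset0Pn[k kK] := K0; exists k.
- reflexivity.
apply: ge_ereal_sup => _ [V pV <-]; have [mV _] := pV.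
have mSV := measurableI _ _ mS mV.
apply: lee_pdiv_invr => //.
- apply: le_lt_trans (haar_precompact_fin hmu pV).
  by apply: le_measure; rewrite ?inE //; exact: subIsetr.
- exact: disjoint_translates_le_mu_ext.
Qed.

(** This serves to show that a set of positive density is nonempty. *)
Lemma upper_density0 {R : realType} {G : topologicalZmodType}
    {mu : {measure set (borelType G) -> \bar R}} :
  (upper_density mu set0 <= 0)%E.
Proof.
apply: ge_ereal_inf; eexists; first exists [set 0].
- by split; [exact: compact_set1|exists 0].
- reflexivity.
by apply: ge_ereal_sup => _ [V _ <-]; rewrite set0I measure0 mul0e.
Qed.

Lemma diffset_sym {G : zmodType} (S : set G) (g : G) :
  diffset S S g -> diffset S S (- g).
Proof. by move=> [s Ss [t St <-]]; exists t => //; exists s => //; rewrite opprB. Qed.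

(** The bound [N] yields an admissible [K] of largest cardinality. A point [g] outside K + (S - S)
    could be added to it, contradicting maximality. *)
Lemma maximal_disjoint_translates {G : zmodType} {S : set G} (N : nat) :
  S !=set0 -> (forall K, disjoint_translates S K -> (#|` K| <= N)%N) ->
  exists2 K, disjoint_translates S K & [set: G] = sumset [set` K] (diffset S S).
Proof.
move=> [s Ss] leN.
(* The maximum is taken over the cardinalities that occur; the empty family realises [0]. *)
pose P n := `[< exists2 K, disjoint_translates S K & #|` K| = n >].
have exP : exists n, P n.
  by exists 0%N; apply/asboolP; exists fset0; rewrite ?cardfs0 // => k l; rewrite inE.
have leP n : P n -> (n <= N)%N by move=> /asboolP[K /leN + <-].
case: (ex_maxnP exP leP) => _ /asboolP[K dK <-] maxK.
exists K => //; apply/seteqP; split => // g _; apply: contrapT => gK.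
have nd k : k \in K -> ~ diffset S S (g - k).
  move=> kK dgk; apply: gK; exists k => //; exists (g - k) => //.
  by rewrite addrC subrK.
(* Since [S] is nonempty, [0] lies in S - S, so [nd] excludes [g] itself from [K]; adding [g] thus
   raises the cardinality. *)
have gNK : g \notin K.
  apply/negP => /nd; apply; rewrite subrr; exists s => //; exists s => //.
  by rewrite subrr.
have /maxK : P #|` (g |` K)%fset|.
  apply/asboolP; exists (g |` K)%fset => // k l.
  rewrite !inE => /orP[/eqP->|kK] /orP[/eqP->|lK] kl.
  - by rewrite eqxx in kl.
  - exact: nd.
  - by move/diffset_sym; rewrite opprB; exact: nd.
  - exact: dK.
by rewrite cardfsU1 gNK ltnn.
Qed.

(* [upper_density mu S] lies in [0, 1], so [fine] only reads it as a real. *)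
Theorem corollary2 (R : realType) (G : topologicalZmodType)
    (mu : {measure set (borelType G) -> \bar R}) (S : set (borelType G)) :
  lca_group G -> haar_measure mu -> measurable S ->
  (0 < upper_density mu S)%E ->
  syndetic (diffset S S : set G) /\
  exists K : {fset G},
    [set: G] = sumset [set` K] (diffset S S) /\
    (#|` K|)%:Z <= Num.floor (fine (upper_density mu S))^-1.
Proof.
move=> _ hmu mS D0.
have S0 : (S : set G) !=set0.
  apply/set0P/negP => /eqP S0; move: D0.
  by rewrite S0 ltNge upper_density0.
have le_floor K : disjoint_translates (S : set G) K ->
    #|` K|%:Z <= Num.floor (fine (upper_density mu S))^-1.
  move=> dK; rewrite floor_ge_int.
  (* The empty family is treated apart, because the density bound divides by the cardinality of
     [K]. *)
  have [->|K0] := eqVneq K fset0.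
    by rewrite cardfs0 invr_ge0 fine_ge0 // ltW.
  have n0 : 0 < #|` K|%:R :> R by rewrite ltr0n cardfs_gt0.
  move: D0 (upper_density_le hmu mS dK K0).
  (* Positivity and the bound by the inverse cardinality leave only a finite density [d > 0]; both
     sides can then be inverted. *)
  case: (upper_density mu S) => // d; rewrite lte_fin lee_fin /= => d0.
  by rewrite -[X in _ <= X -> _]div1r ler_pdivlMr // -[d^-1]div1r ler_pdivlMr // mulrC.
have [K dK GK] : exists2 K, disjoint_translates (S : set G) K
    & [set: G] = sumset [set` K] (diffset S S).
  (* The bound must be a natural number, hence the absolute value of the integer floor. *)
  apply: (maximal_disjoint_translates
    `|Num.floor (fine (upper_density mu S))^-1|%N) => // K /le_floor.
  by move=> leK; rewrite -lez_nat (le_trans leK) // abszE ler_norm.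
split; last by exists K; split => //; exact: le_floor.
(* The sign changes because [syndetic] asks for [g + k] in S - S, while the covering gives [g - k]
   there. *)
exists [set - k | k in [set` K]].
  by apply: finite_compact; exact: finite_image.
move=> g; have : [set: G] g by [].
rewrite GK => -[k kK [d Sd <-]]; exists (- k); first by exists k.
by rewrite addrAC subrr add0r.
Qed.
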